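(* For integers $k\ge2$, $\alpha_k\le k^{\frac{\log k}{2}+O(1)}$.
   Context: $\log$ is the natural logarithm. Schnorr's constant $\alpha_k$ is $\alpha_k=\max\|\vec b_1\|^2/\|\vec b_k^*\|^2$, the maximum over all HKZ-reduced bases $(\vec b_1,\dots,\vec b_k)$ of $k$-dimensional lattices, where $\vec b_i^*$ are the Gram–Schmidt vectors ($\vec b_i^*=\vec b_i-\sum_{j<i}\mu_{i,j}\vec b_j^*$, $\mu_{i,j}=\langle\vec b_i,\vec b_j^*\rangle/\|\vec b_j^*\|^2$). A basis is HKZ-reduced if $\vec b_1$ is a shortest nonzero lattice vector and recursively the projection of $(\vec b_2,\dots,\vec b_k)$ orthogonally to $\vec b_1$ is HKZ-reduced. *)

(* Defs.v *)
From HB Require Import structures.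
From mathcomp Require Import all_boot all_order all_algebra.
From mathcomp Require Import all_classical all_reals all_analysis.

Set Implicit Arguments.
Unset Strict Implicit.
Unset Printing Implicit Defensive.

Import Order.TTheory GRing.Theory Num.Theory.

Local Open Scope classical_set_scope.
Local Open Scope ring_scope.

Definition dotv (R : realType) (n : nat) (u v : 'rV[R]_n) : R :=
  \sum_(i < n) u 0 i * v 0 i.

(* The Euclidean norm; the library's [`|v|] on matrices is the max norm. *)
Definition enorm (R : realType) (n : nat) (v : 'rV[R]_n) : R :=
  Num.sqrt (dotv v v).

Definition gs_coef (R : realType) (n : nat) (u v : 'rV[R]_n) : R :=
  dotv u v / enorm v ^+ 2.

(* A list of vectors b_1, ..., b_m is orthogonalized from left to right:
   each new vector is corrected by the list of b_j^* already computed. *)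
Definition gs_step (R : realType) (n : nat) (s : seq 'rV[R]_n) (b : 'rV[R]_n) :=
  rcons s (b - \sum_(v <- s) gs_coef b v *: v).

Definition gs_seq (R : realType) (n : nat) (s : seq 'rV[R]_n) : seq 'rV[R]_n :=
  foldl (@gs_step R n) [::] s.

(* Bases are given by the rows of a matrix, and so are the b_i^*; the
   recursive characterization is [row_gram_schmidt] below. *)
Definition gram_schmidt (R : realType) (k n : nat) (B : 'M[R]_(k, n)) :
    'M[R]_(k, n) :=
  \matrix_(i < k) nth 0 (gs_seq [seq row j B | j <- enum 'I_k]) i.

Lemma size_gs_seq (R : realType) (n : nat) (s : seq 'rV[R]_n) :
  size (gs_seq s) = size s.
Proof.
elim/last_ind: s => [//|s b IHs].
by rewrite /gs_seq foldl_rcons /gs_step !size_rcons -/(gs_seq s) IHs.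
Qed.

Lemma nth_gs_seq (R : realType) (n : nat) (s : seq 'rV[R]_n) (i : nat) :
  (i < size s)%N ->
  nth 0 (gs_seq s) i = nth 0 s i
    - \sum_(j < i) gs_coef (nth 0 s i) (nth 0 (gs_seq s) j) *:
                   nth 0 (gs_seq s) j.
Proof.
elim/last_ind: s => [//|s b IHs]; rewrite size_rcons ltnS => le_is.
have gsE : gs_seq (rcons s b) =
    rcons (gs_seq s) (b - \sum_(v <- gs_seq s) gs_coef b v *: v).
  by rewrite /gs_seq foldl_rcons.
have prefE (j : 'I_i) : nth 0 (gs_seq (rcons s b)) j = nth 0 (gs_seq s) j.
  by rewrite gsE nth_rcons size_gs_seq (leq_trans (ltn_ord j) le_is).
under [in RHS]eq_bigr => j _ do rewrite prefE.
rewrite gsE !nth_rcons size_gs_seq.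
move: le_is; rewrite leq_eqVlt => /orP[/eqP->|lt_is]; last first.
  by rewrite lt_is; exact: IHs.
by rewrite ltnn eqxx (big_nth 0) size_gs_seq big_mkord.
Qed.

Lemma row_gram_schmidt (R : realType) (k n : nat) (B : 'M[R]_(k, n)) (i : 'I_k) :
  row i (gram_schmidt B) = row i B
    - \sum_(j < k | (j < i)%N)
        gs_coef (row i B) (row j (gram_schmidt B)) *: row j (gram_schmidt B).
Proof.
set s := [seq row j B | j <- enum 'I_k].
have szs : size s = k by rewrite size_map size_enum_ord.
have rowE (j : 'I_k) : row j (gram_schmidt B) = nth 0 (gs_seq s) j.
  by rewrite rowK.
have nthE : nth 0 s i = row i B.
  by rewrite (nth_map i) ?size_enum_ord // nth_ord_enum.
rewrite rowE nth_gs_seq ?szs // nthE.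
rewrite (big_ord_widen_cond k xpredT (fun j =>
  gs_coef (row i B) (nth 0 (gs_seq s) j) *: nth 0 (gs_seq s) j)) 1?ltnW //.
by congr (_ - _); apply: eq_bigr => j _; rewrite rowE.
Qed.

Definition lattice (R : realType) (k n : nat) (B : 'M[R]_(k, n)) :
    set 'rV[R]_n :=
  [set v | exists z : 'rV[int]_k, v = map_mx intr z *m B].

Definition shortest_nonzero (R : realType) (n : nat) (L : set 'rV[R]_n)
    (v : 'rV[R]_n) : Prop :=
  [/\ L v, v != 0 & forall w, L w -> w != 0 -> enorm v <= enorm w].

Definition proj_orth (R : realType) (n : nat) (b v : 'rV[R]_n) : 'rV[R]_n :=
  v - gs_coef v b *: b.

Fixpoint hkz_reduced (R : realType) (n k : nat) : 'M[R]_(k, n) -> Prop :=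
  match k with
  | 0 => fun=> True
  | k'.+1 => fun B =>
      shortest_nonzero (lattice B) (row ord0 B) /\
      hkz_reduced (\matrix_(i < k') proj_orth (row ord0 B) (row (lift ord0 i) B))
  end.

(* The values |b_1|^2 / |b_k^*|^2 over all HKZ-reduced bases of k-dimensional
   lattices, in an ambient space R^n of arbitrary dimension. *)
Definition schnorr_ratios (R : realType) (k : nat) : set R :=
  [set r | exists (n : nat) (B : 'M[R]_(k, n)) (first last : 'I_k),
    [/\ first = 0%N :> nat, last = k.-1 :> nat, row_free B, hkz_reduced B &
        r = enorm (row first B) ^+ 2 / enorm (row last (gram_schmidt B)) ^+ 2]].

(* Taken in the extended reals, so that the supremum is a genuine one without
   any prior boundedness or attainment result. *)
Definition schnorr_alpha (R : realType) (k : nat) : \bar R :=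
  ereal_sup [set r%:E | r in @schnorr_ratios R k].

(* Main.v *)
(* Minkowski's theorem in the form lambda_1^2 <= 4 d det^(2/d) for rank d is
   applied to every projected lattice of an HKZ basis. If m_d is the mean of
   the d last values of ln |b_j^*|, then the preceding value x satisfies
   x <= ln (4 (d+1)) / 2 + m_(d+1), so
   m_(d+1) - m_d <= ln (4 (d+1)) / (2 d); summing gives (ln k)^2 / 4 + O(ln k),
   and squaring the norms doubles this exponent.
   Minkowski's theorem itself is a pigeonhole argument: choosing the integer
   coefficients from the last to the first exhibits many lattice points in a
   large cube of the Gram-Schmidt frame, so two of them share a small cell. *)

Require Import Defs.
From HB Require Import structures.
From mathcomp Require Import all_boot all_order all_algebra.
From mathcomp Require Import all_classical all_reals all_analysis.
From mathcomp Require Import ring lra.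

Set Implicit Arguments.
Unset Strict Implicit.
Unset Printing Implicit Defensive.

Import Order.TTheory GRing.Theory Num.Theory.

Local Open Scope ring_scope.

(** * Inner product, orthogonal projection and the recursive form of Gram-Schmidt *)

Section Euclid.
Variables (R : realType) (n : nat).
Implicit Types (u v w b : 'rV[R]_n) (a : R).

Lemma dotvC u v : dotv u v = dotv v u.
Proof. by apply: eq_bigr => i _; rewrite mulrC. Qed.

Lemma dotvDl u v w : dotv (u + v) w = dotv u w + dotv v w.
Proof. by rewrite -big_split; apply: eq_bigr => i _; rewrite mxE mulrDl. Qed.

Lemma dotvZl a u v : dotv (a *: u) v = a * dotv u v.
Proof. by rewrite mulr_sumr; apply: eq_bigr => i _; rewrite mxE mulrA. Qed.

Lemma dotvBl u v w : dotv (u - v) w = dotv u w - dotv v w.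
Proof. by rewrite dotvDl -scaleN1r dotvZl mulN1r. Qed.

Lemma dotv_ge0 u : 0 <= dotv u u.
Proof. by apply: sumr_ge0 => i _; rewrite -expr2 sqr_ge0. Qed.

Lemma dot0v u : dotv 0 u = 0.
Proof. by rewrite -(scale0r 0) dotvZl mul0r. Qed.

Lemma dotv_eq0 u : dotv u u = 0 -> u = 0.
Proof.
move/eqP; rewrite psumr_eq0 => [/allP u0|i _]; last by rewrite -expr2 sqr_ge0.
apply/rowP => i; rewrite mxE; apply/eqP.
by have := u0 i (mem_index_enum _); rewrite -expr2 sqrf_eq0.
Qed.

Lemma enorm_sqr u : enorm u ^+ 2 = dotv u u.
Proof. by rewrite sqr_sqrtr // dotv_ge0. Qed.

Lemma enorm_gt0 u : u != 0 -> 0 < enorm u.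
Proof.
move=> u0; rewrite sqrtr_gt0 lt_neqAle dotv_ge0 andbT eq_sym.
by apply: contra_neq u0; exact: dotv_eq0.
Qed.

Lemma gs_coefD u v b : gs_coef (u + v) b = gs_coef u b + gs_coef v b.
Proof. by rewrite /gs_coef dotvDl mulrDl. Qed.

Lemma gs_coefZ a u b : gs_coef (a *: u) b = a * gs_coef u b.
Proof. by rewrite /gs_coef dotvZl mulrA. Qed.

Lemma proj_orthD u v b : proj_orth b (u + v) = proj_orth b u + proj_orth b v.
Proof. by rewrite /proj_orth gs_coefD scalerDl opprD addrACA. Qed.

Lemma proj_orthZ a u b : proj_orth b (a *: u) = a *: proj_orth b u.
Proof. by rewrite /proj_orth gs_coefZ scalerBr scalerA. Qed.

Lemma proj_orthv b : proj_orth b b = 0.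
Proof.
have [->|b0] := eqVneq b 0; first by rewrite /proj_orth scaler0 subr0.
rewrite /proj_orth /gs_coef -enorm_sqr divff ?scale1r ?subrr //.
by rewrite sqrf_eq0 gt_eqF // enorm_gt0.
Qed.

Lemma dotv_proj_orth b v : dotv (proj_orth b v) b = 0.
Proof.
have [->|b0] := eqVneq b 0; first by rewrite dotvC dot0v.
rewrite dotvBl dotvZl /gs_coef enorm_sqr divfK ?subrr //.
by rewrite -enorm_sqr sqrf_eq0 gt_eqF // enorm_gt0.
Qed.

Lemma pythagoras b v : b != 0 ->
  dotv v v = (dotv v b / enorm b) ^+ 2 + dotv (proj_orth b v) (proj_orth b v).
Proof.
move=> b0; have pb := dotv_proj_orth b v; set p := proj_orth b v in pb *.
have e0 := enorm_gt0 b0.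
have vb : dotv v b = gs_coef v b * enorm b ^+ 2.
  by rewrite /gs_coef divfK // sqrf_eq0 gt_eqF.
have vE : v = p + gs_coef v b *: b by rewrite /p subrK.
rewrite {1}vE dotvDl dotvZl (dotvC b v) (dotvC p v) {1}vE dotvDl dotvZl.
by rewrite (dotvC b p) pb vb; field; rewrite gt_eqF.
Qed.

(** Later Gram-Schmidt vectors are orthogonal to [b], so removing the [b] component of an input
    beforehand changes none of its coefficients along them. This turns left-to-right
    orthogonalization into the recursion of [hkz_reduced]. *)
Lemma gs_seq_cons b (s : seq 'rV[R]_n) :
  gs_seq (b :: s) = b :: gs_seq (map (proj_orth b) s).
Proof.
(* The orthogonality to [b] has to be carried through the induction. *)
suff [] : gs_seq (b :: s) = b :: gs_seq (map (proj_orth b) s) /\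
    {in gs_seq (map (proj_orth b) s), forall v, dotv v b = 0} by [].
elim/last_ind: s => [|s v [IH orth]].
  by split=> //; rewrite /gs_seq /= /gs_step /= big_nil subr0.
have gsE : gs_seq (map (proj_orth b) (rcons s v)) =
    gs_step (gs_seq (map (proj_orth b) s)) (proj_orth b v).
  by rewrite map_rcons /gs_seq foldl_rcons.
rewrite gsE; split.
  rewrite -rcons_cons /gs_seq foldl_rcons -/(gs_seq _) IH /gs_step rcons_cons.
  rewrite big_cons opprD addrA; congr (_ :: rcons _ (_ - _)).
  rewrite !big_seq; apply: eq_bigr => w /orth wb; congr (_ *: _).
  by rewrite /gs_coef dotvBl dotvZl (dotvC b) wb mulr0 subr0.
move=> w; rewrite mem_rcons inE => /orP[/eqP->|]; last exact: orth.
rewrite dotvBl dotv_proj_orth sub0r; apply/eqP; rewrite oppr_eq0 big_seq.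
elim/big_ind: _ => [|x y /eqP x0 /eqP y0|x /orth xb]; first by rewrite dot0v.
  by rewrite dotvDl x0 y0 addr0.
by rewrite dotvZl xb mulr0.
Qed.

End Euclid.

(** * Lattice vectors and their projections *)

Section Lattices.
Variables (R : realType) (n : nat).

Definition latv (k : nat) (z : 'rV[int]_k) (B : 'M[R]_(k, n)) : 'rV[R]_n :=
  map_mx intr z *m B.

Definition proj_tail (k : nat) (B : 'M[R]_(k.+1, n)) : 'M[R]_(k, n) :=
  \matrix_(i < k) proj_orth (row ord0 B) (row (lift ord0 i) B).

(** The norms of the Gram-Schmidt vectors, computed by successive projection so that inductions run
    parallel to [hkz_reduced]; [gs_normsE] gives the link to [gs_seq]. *)
Fixpoint gs_norms (k : nat) : 'M[R]_(k, n) -> seq R :=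
  match k with
  | 0 => fun=> [::]
  | k'.+1 => fun B => enorm (row ord0 B) :: gs_norms (proj_tail B)
  end.

Lemma size_gs_norms k (B : 'M[R]_(k, n)) : size (gs_norms B) = k.
Proof. by elim: k B => //= k IH B; rewrite IH. Qed.

Lemma gs_normsE k (B : 'M[R]_(k, n)) :
  gs_norms B = map (@enorm R n) (gs_seq [seq row i B | i <- enum 'I_k]).
Proof.
elim: k B => [|k IH] B; first by rewrite (size0nil (size_enum_ord 0)).
rewrite enum_ordSl [RHS]/= gs_seq_cons /= IH; congr (_ :: map _ (gs_seq _)).
by rewrite -!map_comp; apply: eq_map => i /=; rewrite rowK.
Qed.

Lemma latvB k (z w : 'rV[int]_k) (B : 'M[R]_(k, n)) :
  latv (z - w) B = latv z B - latv w B.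
Proof. by rewrite /latv map_mxB mulmxBl. Qed.

Lemma row_row' m k (A : 'M[R]_(k.+1, m)) j :
  row j (row' ord0 A) = row (lift ord0 j) A.
Proof. by apply/rowP => l; rewrite !mxE. Qed.

Lemma latv_recl k (z : 'rV[int]_k.+1) (B : 'M[R]_(k.+1, n)) :
  latv z B = (z 0 0)%:~R *: row ord0 B + latv (col' 0 z) (row' 0 B).
Proof.
rewrite /latv mulmx_sum_row big_ord_recl mxE; congr (_ + _).
by rewrite mulmx_sum_row; apply: eq_bigr => i _; rewrite !mxE row_row'.
Qed.

Lemma proj_orth_latv k (z : 'rV[int]_k.+1) (B : 'M[R]_(k.+1, n)) :
  proj_orth (row ord0 B) (latv z B) = latv (col' 0 z) (proj_tail B).
Proof.
rewrite latv_recl proj_orthD proj_orthZ proj_orthv scaler0 add0r.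
rewrite /latv !mulmx_sum_row.
have p0 : proj_orth (row ord0 B) 0 = 0.
  by rewrite /proj_orth /gs_coef dot0v mul0r scale0r subr0.
rewrite (big_morph (proj_orth (row ord0 B)) (fun u v => proj_orthD u v _) p0).
by apply: eq_bigr => i _; rewrite proj_orthZ rowK row_row' !mxE.
Qed.

(** * Minkowski's theorem by pigeonhole *)

Definition row_cons k (m : int) (z : 'rV[int]_k) : 'rV[int]_k.+1 :=
  \row_i oapp (z 0) m (unlift 0 i).

Lemma row_cons0 k m (z : 'rV[int]_k) : row_cons m z 0 0 = m.
Proof. by rewrite mxE unlift_none. Qed.

Lemma col'_row_cons k m (z : 'rV[int]_k) : col' 0 (row_cons m z) = z.
Proof. by apply/rowP => i; rewrite !mxE liftK. Qed.

(* [cell z] is the subcube of side [s] that contains [z] in the Gram-Schmidt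
   frame; the points of [L] all lie in the cube of side [M.+1 * s], which
   along a direction of norm [a] leaves [truncn (M.+1 * s / a)] choices. *)
Lemma latv_box k (B : 'M[R]_(k, n)) (s : R) (M : nat) :
  0 < s -> all (fun a => 0 < a) (gs_norms B) ->
  exists (L : seq 'rV[int]_k) (cell : 'rV[int]_k -> k.-tuple 'I_M.+1),
    [/\ uniq L,
        size L = (\prod_(a <- gs_norms B) Num.truncn (M.+1%:R * s / a))%N &
        {in L &, forall z w, cell z = cell w ->
           enorm (latv (z - w) B) ^+ 2 <= k%:R * s ^+ 2}].
Proof.
move=> s0; elim: k B => [|k IH] B.
  move=> _; exists [:: 0], (fun=> [tuple]); split=> //.
    by rewrite big_nil.
  by move=> z w _ _ _; rewrite enorm_sqr /latv !thinmx0 mul0mx dot0v mul0r.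
move=> /= /andP[b0 /IH[L [cell [uL sL cellP]]]].
set b := row ord0 B in b0 *; set e := enorm b in b0.
have bn0 : b != 0 
  by apply: contraTneq b0; rewrite /e /enorm => ->; rewrite dot0v sqrtr0 ltxx.
set N := Num.truncn (M.+1%:R * s / e).
pose x z := dotv (latv z (row' 0 B)) b / e ^+ 2.
pose c z := dotv (latv z B) b / e.
(* Subtracting the floor of [x z] puts the component along [b] into the interval from [m * e] to
   [m.+1 * e], so the [N] values of [m] stay within the side of the cube. *)
pose lift_pt z m := row_cons (m%:Z - Num.floor (x z)) z.
exists [seq lift_pt z m | z <- L, m <- iota 0 N].
(* The new entry is the index of the slab of width [s] orthogonal to [b]. By [c_bound] it is below
   [M.+1] on the chosen points, so [inord] leaves it unchanged. *)
exists (fun z => [tuple of inord (Num.truncn (c z / s)) :: cell (col' 0 z)]).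
have cE z m : c (lift_pt z m) = (m%:R + (x z - (Num.floor (x z))%:~R)) * e.
  rewrite /c latv_recl row_cons0 col'_row_cons dotvDl dotvZl -enorm_sqr -/b -/e.
  by rewrite /x; field; rewrite gt_eqF.
have c_bound z m : (m < N)%N -> 0 <= c (lift_pt z m) / s < M.+1%:R.
  move=> mN; have /andP[fx1 fx2] := floor_itv (x z).
  rewrite intrD in fx2.
  rewrite cE; apply/andP; split.
    apply: divr_ge0; last exact: ltW.
    by apply: mulr_ge0; [rewrite addr_ge0 // subr_ge0|exact: ltW].
  rewrite ltr_pdivrMr //; apply: (@lt_le_trans _ _ (m.+1%:R * e)).
    by rewrite ltr_pM2r // -natr1 ltrD2l ltrBlDl.
  rewrite -ler_pdivlMr //; apply: (@le_trans _ _ N%:R).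
    by rewrite ler_nat.
  by rewrite truncn_le divr_ge0 ?mulr_ge0 // ltW.
split.
- apply: allpairs_uniq => //; first exact: iota_uniq.
  move=> [z m] [w l] _ _ /= E.
  have zw : z = w.
    by have := congr1 (col' 0) E; rewrite !col'_row_cons.
  have := congr1 (fun t : 'rV[int]_k.+1 => t 0 0) E.
  by rewrite !row_cons0 zw => /addIr[->].
- by rewrite size_allpairs size_iota big_cons sL mulnC.
move=> _ _ /allpairsP[[z m] /= [zL]] + -> /allpairsP[[w l] /= [wL]] + ->.
rewrite !mem_iota add0n => /andP[_ mN] /andP[_ lN] E.
have /= [Et Ec] := congr1 val E.
rewrite !col'_row_cons in Ec.
have /andP[cz0 czM] := c_bound z m mN; have /andP[cw0 cwM] := c_bound w l lN.
move: Et => /(congr1 val) /= Et.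
rewrite inordK ?truncn_lt_nat // inordK ?truncn_lt_nat // in Et.
have /andP[] := truncn_itv cz0; have /andP[] := truncn_itv cw0.
rewrite Et -natr1; set t := _%:R => tw1 tw2 tz1 tz2.
(* Sharing a slab bounds the component along [b] by [s]; the induction hypothesis bounds the
   projection. *)
rewrite enorm_sqr (pythagoras _ bn0) proj_orth_latv raddfB /= !col'_row_cons.
rewrite -enorm_sqr latvB dotvBl mulrBl -/(c _) -/(c _).
rewrite -natr1 mulrDl mul1r [leRHS]addrC lerD //; last first.
  by apply: cellP => //; apply: val_inj.
rewrite -ler_sqrt; last exact: sqr_ge0.
rewrite !sqrtr_sqr (ger0_norm (ltW s0)).
rewrite -[leRHS]mul1r -ler_pdivrMr // -{1}(gtr0_norm s0) -normf_div mulrBl.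
by rewrite ler_norml; apply/andP; split; lra.
Qed.

(** Projecting away the first row forces the other coefficients to vanish by induction; what remains
    is a multiple of a nonzero row. *)
Lemma latv_eq0 k (z : 'rV[int]_k) (B : 'M[R]_(k, n)) :
  all (fun a => 0 < a) (gs_norms B) -> latv z B = 0 -> z = 0.
Proof.
elim: k z B => [|k IH] z B; first by rewrite thinmx0.
move=> /= /andP[b0 tail0] zB0.
have z'0 : col' 0 z = 0.
  apply: (IH _ (proj_tail B)) => //.
  by rewrite -proj_orth_latv zB0 /proj_orth /gs_coef dot0v mul0r scale0r subr0.
have z00 : z 0 0 = 0.
  have := latv_recl z B; rewrite zB0 z'0 /latv map_mx0 mul0mx addr0.
  move/esym/eqP; rewrite scaler_eq0 intr_eq0 => /orP[/eqP//|/eqP r0].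
  by move: b0; rewrite r0 /enorm dot0v sqrtr0 ltxx.
apply/rowP => i; rewrite mxE.
have [j|] := unliftP ord0 i => -> //.
by have /rowP/(_ j) := z'0; rewrite !mxE.
Qed.

Lemma minkowski k (B : 'M[R]_(k.+1, n)) (s : R) :
  all (fun a => 0 < a) (gs_norms B) -> 0 < s ->
  \prod_(a <- gs_norms B) a <= s ^+ k.+1 ->
  exists2 z : 'rV[int]_k.+1,
    latv z B != 0 & enorm (latv z B) ^+ 2 <= k.+1%:R * (2 * s) ^+ 2.
Proof.
move=> pos s0 prod_le.
have szl := size_gs_norms B; set l := gs_norms B in szl pos prod_le *.
(* The cube must be at least as wide as every norm: then each ratio [M.+1 * s / a] is at least 1, as
   the rounding estimate below requires. *)
have [M M_le] : exists M, {in l, forall a, a <= M.+1%:R * s}.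
  set S := \sum_(a <- l) a.
  exists (Num.truncn (S / s)) => a aB.
  apply: (@le_trans _ _ S).
    rewrite /S (big_rem _ aB) lerDl big_seq sumr_ge0 // => x xB.
    by rewrite ltW // (allP pos) // (mem_rem xB).
  have S0 : 0 <= S by rewrite /S big_seq sumr_ge0 // => x /(allP pos)/ltW.
  rewrite -ler_pdivrMr //.
  by have /andP[_ /ltW] := truncn_itv (divr_ge0 S0 (ltW s0)).
(* Cells of side [2 * s] pay for rounding down: if [y] is at least 1, then [truncn (2 * y)] exceeds
   [2 * y - 1], hence [y]. So there are strictly more points than cells. *)
have s2 : 0 < 2 * s by rewrite mulr_gt0.
have [L [cell [uL sL cellP]]] := latv_box M s2 pos.
rewrite -/l in sL.
have LM : (M.+1 ^ k.+1 < size L)%N.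
  rewrite sL -(ltr_nat R) natrX natr_prod.
  apply: (@le_lt_trans _ _ (\prod_(a <- l) (M.+1%:R * s / a))).
    rewrite big_split /= prodfV big_const_seq count_predT.
    rewrite szl iter_mulr_1 exprMn ler_pdivlMr; last first.
      by rewrite big_seq prodr_gt0 // => a /(allP pos).
    by rewrite ler_pM2l // exprn_gt0.
  rewrite big_seq [ltRHS]big_seq; apply: ltr_prod.
    by apply/hasP; exists (enorm (row ord0 B)); rewrite [l]/= inE eqxx.
  move=> a aB; have a0 := allP pos a aB.
  have a1 : 1 <= M.+1%:R * s / a by rewrite ler_pdivlMr // mul1r M_le.
  apply/andP; split; first by rewrite (le_trans ler01).
  have -> : M.+1%:R * (2 * s) / a = 2 * (M.+1%:R * s / a) by ring.
  set y := _ / a in a1 *; have y0 : 0 <= 2 * y by lra.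
  by have := truncn_itv y0; rewrite -natr1 => /andP[_]; lra.
have [cell_inj|] := pselect {in L &, injective cell}.
  have : uniq (map cell L) by rewrite map_inj_in_uniq.
  move/card_uniqP; rewrite size_map => szE.
  have := max_card (mem (map cell L)).
  by rewrite szE card_tuple card_ord leqNgt LM.
move=> not_inj.
have [z [w [zL wL zw E]]] :
    exists z w, [/\ z \in L, w \in L, cell z = cell w & z != w].
  apply: contrapT => H; apply: not_inj => z w zL wL E.
  by apply/eqP/negP => /negP zw; apply: H; exists z, w.
exists (z - w); last exact: cellP.
by apply: contra_neq E => /(latv_eq0 pos)/eqP; rewrite subr_eq0 => /eqP.
Qed.

(** * Minkowski's bound along an HKZ-reduced basis *)

Lemma hkz_norms_gt0 k (B : 'M[R]_(k, n)) :
  hkz_reduced B -> all (fun a => 0 < a) (gs_norms B).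
Proof.
elim: k B => //= k IH B [[_ b0 _] hB]; rewrite enorm_gt0 //=; exact: IH.
Qed.

(* Minkowski's bound for the logarithms of the norms, at every suffix. *)
Fixpoint hermite_profile (s : seq R) : Prop :=
  if s is x :: s' then
    x <= ln (4 * (size s)%:R) / 2 + (\sum_(y <- s) y) / (size s)%:R /\
    hermite_profile s'
  else True.

Lemma hkz_hermite_profile k (B : 'M[R]_(k, n)) :
  hkz_reduced B -> hermite_profile (map (@ln R) (gs_norms B)).
Proof.
elim: k B => // k IH B hB; have pos := hkz_norms_gt0 hB.
have [[_ b0 shortest] hB'] := hB.
split; last exact: IH.
rewrite -/(map (@ln R) (gs_norms (proj_tail B))).
rewrite -[_ :: _]/(map (@ln R) (gs_norms B)).
rewrite size_map size_gs_norms; set S := \sum_(_ <- _) _.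
have kn0 : k.+1%:R != 0 :> R by rewrite pnatr_eq0.
have prodE : \prod_(a <- gs_norms B) a = expR (S / k.+1%:R) ^+ k.+1.
  rewrite -expRM_natr divfK // /S big_map expR_sum.
  by apply: eq_big_seq => a /(allP pos) a0; rewrite lnK.
(* The choice of [s] is the geometric mean of the norms, the least value that [minkowski] admits. *)
have [||z z0 zle] := @minkowski _ B (expR (S / k.+1%:R)) pos.
    exact: expR_gt0.
  by rewrite prodE.
have e0 := enorm_gt0 b0.
have : enorm (row ord0 B) ^+ 2 <= k.+1%:R * (2 * expR (S / k.+1%:R)) ^+ 2.
  apply: le_trans zle; rewrite lerXn2r ?nnegrE ?sqrtr_ge0 //.
  by apply: shortest => //; exists z.
rewrite exprMn mulrA -ler_ln ?posrE ?exprn_gt0 ?mulr_gt0 ?expR_gt0 ?ltr0n //.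
rewrite lnXn // lnM ?posrE ?exprn_gt0 ?expR_gt0 ?mulr_gt0 ?ltr0n //.
rewrite lnXn ?expR_gt0 //.
rewrite expRK -natrX (mulrC k.+1%:R) -[(2 ^ 2)%N]/4%N => H.
move: H; move: (ln _) (ln _) (S / _) => a b c.
by rewrite (mulr2n b) (mulr2n c) => H; lra.
Qed.

End Lattices.

(** * Growth of the means of the logarithms *)

Section Growth.
Variable R : realType.

Lemma ln4_le3 : ln 4 <= 3 :> R.
Proof.
have -> : 4 = 1 + 3 :> R by ring.
by apply: le_ln1Dx; lra.
Qed.

(** The increment of half the squared logarithm is about [ln k / k], which matches the main term on
    the left; the summand with factor 8 absorbs the errors of order [1 / k]. *)
Lemma ln_sqr_step (k : nat) : (0 < k)%N ->
  ln k%:R ^+ 2 / 2 + 8 * ln k%:R + ln (4 * k.+1%:R) / k%:R <=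
  ln k.+1%:R ^+ 2 / 2 + 8 * ln k.+1%:R :> R.
Proof.
move=> k0; have k0' : 0 < k%:R :> R by rewrite ltr0n.
have k1' : 0 < k.+1%:R :> R by rewrite ltr0n.
set l := ln k%:R; set L := ln k.+1%:R.
have kS : k.+1%:R = k%:R + 1 :> R by rewrite natr1.
have L0 : 0 <= L by rewrite ln_ge0 // ler1n.
have k1 : 1 <= k%:R :> R by rewrite ler1n.
have u_ub : L - l <= 1 / k%:R.
  rewrite /L /l -ln_div ?posrE //.
  have -> : k.+1%:R / k%:R = 1 + 1 / k%:R :> R.
    by rewrite kS; field; rewrite gt_eqF.
  by apply: le_ln1Dx; rewrite (lt_le_trans (ltrN10 _)) // divr_ge0.
have u_lb : 1 / k.+1%:R <= L - l.
  rewrite -lerN2 opprB /L /l -ln_div ?posrE //.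
  have -> : k%:R / k.+1%:R = 1 + - (1 / k.+1%:R) :> R.
    by rewrite kS; field; rewrite -kS gt_eqF.
  apply: le_ln1Dx; rewrite ltrN2 ltr_pdivrMr // mul1r kS; lra.
have L_ub : L <= k%:R by rewrite /L -natr1 addrC le_ln1Dx //; lra.
have ln4 := ln4_le3.
have -> : ln (4 * k.+1%:R) = ln 4 + L by rewrite lnM ?posrE.
have u1 : L - l <= 1.
  by apply: le_trans u_ub _; rewrite ler_pdivrMr // mul1r.
have -> : L ^+ 2 / 2 + 8 * L =
    l ^+ 2 / 2 + 8 * l + (L - l) * (L - (L - l) / 2 + 8).
  by field.
rewrite lerD2l; set u := L - l in u_ub u_lb u1 *.
(* The 7 comes from [ln 4 * (k + 1) + L <= 3 * (k + 1) + k <= 7 * k]. One more unit, making 8,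
   covers the loss of [(L - l) / 2]. *)
apply: (@le_trans _ _ (1 / k.+1%:R * (L + 7))).
  have -> : 1 / k.+1%:R * (L + 7) = (L + 7) / k.+1%:R by rewrite mulrAC mul1r.
  rewrite ler_pdivrMr // mulrAC ler_pdivlMr // kS; nra.
have u0 : 0 <= u by apply: le_trans u_lb; rewrite divr_ge0 // ltW.
apply: ler_pM => //; lra.
Qed.

(** Induction from the last entry, whose mean is itself: each prepended entry raises the mean by at
    most half the increment estimated in [ln_sqr_step]. *)
Lemma hermite_profile_mean (x : R) (s : seq R) :
  hermite_profile (x :: s) ->
  (\sum_(y <- x :: s) y) / (size s).+1%:R <=
  last x s + (ln (size s).+1%:R ^+ 2 / 2 + 8 * ln (size s).+1%:R) / 2.
Proof.
elim: s x => [|y s IH] x; first by move=> _; rewrite big_seq1 ln1 /=; lra.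
move=> [x_le /IH]; set l := last y s; rewrite -[last x _]/l.
set S := \sum_(_ <- y :: s) _; rewrite big_cons -/S in x_le *.
have := @ln_sqr_step (size s).+1 isT.
rewrite -[size (x :: _)]/((size s).+2) -[size (y :: _)]/((size s).+1) in x_le *.
set F := _ / 2 + 8 * _; set G := ln (4 * _) in x_le *.
set F' := _ / 2 + 8 * _.
set e := (size s).+1%:R; have e1 : 1 <= e by rewrite ler1n.
have eS : (size s).+2%:R = e + 1 by rewrite /e natr1.
rewrite eS in x_le *.
rewrite !ler_pdivrMr; try lra.
move=> step mean.
have e0 : 0 < e by lra.
(* The mean in the bound contains [x] itself; solving for [x] leaves the factor [e] in place of
   [e + 1]. *)
have xe : x * e <= G / 2 * (e + 1) + S.
  have : x * (e + 1) <= (G / 2 + (x + S) / (e + 1)) * (e + 1).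
    by rewrite ler_pM2r //; lra.
  by rewrite [leRHS]mulrDl divfK; lra.
move: step; rewrite -lerBrDl ler_pdivrMr // => step.
rewrite -(ler_pM2r e0).
have : (G / 2 + S) * (e + 1) <= ((F' - F) / 2 * e + (l + F / 2) * e) * (e + 1).
  by rewrite ler_pM2r //; lra.
lra.
Qed.

End Growth.

(** * The bound for Schnorr's constant *)

Lemma last_gs_norms (R : realType) (n k : nat) (B : 'M[R]_(k.+1, n))
    (i : 'I_k.+1) (x : R) :
  i = k :> nat -> last x (gs_norms B) = enorm (row i (gram_schmidt B)).
Proof.
move=> ik; have szE : size (gs_seq [seq row j B | j <- enum 'I_k.+1]) = k.+1.
  by rewrite size_gs_seq size_map size_enum_ord.
rewrite gs_normsE rowK (last_nth x) size_map szE.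
(* [last_nth] counts the default [x] as entry 0, so entry [k.+1] of the extended list is entry [k]
   of the norms. *)
rewrite -(nth_behead x) [behead _]/= (nth_map 0) ?szE // ik //.
Qed.

Theorem theorem4 (R : realType) :
  exists C : R, forall k : nat, (2 <= k)%N ->
    (schnorr_alpha R k <= (k%:R `^ (ln k%:R / 2 + C))%:E)%E.
Proof.
(* Twice the difference of the logarithms is at most [L ^+ 2 / 2 + 9 * L + ln 4], and
   [ln 4 <= 3 <= 6 * L]; hence 15 = 9 + 6. *)
exists 15 => -[//|k] k2; apply: ge_ereal_sup => _ /= [r + <-].
case=> n [B] [i] [j] [i0 jk _ hB ->]; rewrite lee_fin.
have pos := hkz_norms_gt0 hB.
have := hkz_hermite_profile hB.
have -> : i = ord0 by exact: val_inj.
have lastE := last_gs_norms B 0 jk.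
set el := enorm _ in lastE *; set e1 := enorm (row ord0 B).
have e10 : 0 < e1 by case/andP: pos.
have el0 : 0 < el by rewrite -lastE (allP pos) //= mem_last.
pose s := map (@ln R) (gs_norms (proj_tail B)).
have -> : map (@ln R) (gs_norms B) = ln e1 :: s by [].
have szs : size s = k by rewrite size_map size_gs_norms.
move=> prof; have mean := hermite_profile_mean prof.
case: prof => x_le _; move: x_le mean.
have -> : last (ln e1) s = ln el by rewrite -lastE /= last_map.
rewrite -[size (_ :: _)]/((size s).+1) szs.
set m := _ / k.+1%:R; rewrite lnM ?posrE ?ltr0n //.
set L := ln k.+1%:R => x_le mean.
(* Dimension at least 2 keeps [L] away from 0, so that the additive constant becomes a multiple of
   [L]. *)
have L_lb : 1 <= 2 * L.
  have : ln 2 <= L by rewrite ler_ln ?posrE ?ltr0n // ler_nat.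
  have : ln 2^-1 <= - 2^-1 :> R.
    by rewrite (_ : ln 2^-1 = ln (1 + - 2^-1)) ?le_ln1Dx; [|lra|congr ln; lra].
  by rewrite lnV ?posrE //; lra.
have -> : e1 ^+ 2 / el ^+ 2 = expR (2 * (ln e1 - ln el)).
  by rewrite -expr_div_n (mulrC 2) expRM_natr expRB !lnK ?posrE.
rewrite /powR pnatr_eq0 /= ler_expR -/L.
by have := ln4_le3 R; lra.
Qed.
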